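(* Let $\boldsymbol\lambda=(\lambda_1,\lambda_2)\in(\mathbb{F}_q^* )^2$. (i) Let $\chi=(\alpha_1,\alpha_2,\beta_1,\beta_2,\gamma,\psi_c)$ be a character of $(\mathbb{F}_q^* )^5\times\mathbb{F}_q$ with $c\in\mathbb{F}_q^*$. If $\varepsilon\notin\{\alpha_1\beta_1,\alpha_2\beta_2\}$, then $$N(X_{\Phi_1,\boldsymbol\lambda};\chi)=-g(\gamma)\overline\gamma(c)j(\alpha_1,\beta_1)j(\alpha_2,\beta_2)\,\Phi_1\left({\alpha_1;\alpha_2\atop\overline{\beta_1};\overline{\beta_2},\overline\gamma};\lambda_1,c\lambda_2\right)_\psi.$$ (ii) Let $\chi=(\alpha,\beta,\gamma_1,\gamma_2,\psi_{c_1},\psi_{c_2})$ be a character of $(\mathbb{F}_q^* )^4\times\mathbb{F}_q^2$ with $c_1,c_2\in\mathbb{F}_q^*$. If $\alpha\beta\ne\varepsilon$, then $$N(X_{\Phi_3,\boldsymbol\lambda};\chi)=-\Big(\prod_{j=1}^2g(\gamma_j)\overline{\gamma_j}(c_j)\Big)j(\alpha,\beta)\,\Phi_3\left({\alpha\atop\overline{\gamma_1};\overline\beta,\overline{\gamma_2}};c_1\lambda_1,c_1c_2\lambda_2\right)_\psi.$$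
   Context: $q$ is a power of a prime $p$, $N=q-1$, $\psi$ a fixed nontrivial additive character of $\mathbb{F}_q$, $\psi_a(x)=\psi(ax)$. Multiplicative characters: $\eta(0)=0$, $\overline\eta=\eta^{-1}$, $\varepsilon$ trivial, $\delta(\eta)=1$ iff $\eta=\varepsilon$; $g(\eta)=-\sum_{x\in\mathbb{F}_q^*}\psi(x)\eta(x)$, $g^\circ(\eta)=q^{\delta(\eta)}g(\eta)$, $j(\eta_1,\eta_2)=-\sum_{x_1+x_2=1,\,x_i\ne0}\eta_1(x_1)\eta_2(x_2)$, $(\alpha)_\nu=g(\alpha\nu)/g(\alpha)$, $(\alpha)^\circ_\nu=g^\circ(\alpha\nu)/g^\circ(\alpha)$. With sums over characters $\mu,\nu$ of $\mathbb{F}_q^*$: $\Phi_1\left({\alpha;\beta\atop\gamma;\delta_1,\delta_2};\lambda_1,\lambda_2\right)_\psi=\frac1{(1-q)^2}\sum_{\mu,\nu}\frac{(\alpha)_{\mu\nu}(\beta)_\mu}{(\gamma)^\circ_{\mu\nu}(\delta_1)^\circ_\mu(\delta_2)^\circ_\nu}\mu(\lambda_1)\nu(\lambda_2)$, $\Phi_3\left({\beta\atop\gamma;\delta_1,\delta_2};\lambda_1,\lambda_2\right)_\psi=\frac1{(1-q)^2}\sum_{\mu,\nu}\frac{(\beta)_\mu}{(\gamma)^\circ_{\mu\nu}(\delta_1)^\circ_\mu(\delta_2)^\circ_\nu}\mu(\lambda_1)\nu(\lambda_2)$. $X_{\Phi_1,\boldsymbol\lambda}$: affine variety over $\mathbb{F}_q$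 in coordinates $(x_1,x_2,y_1,y_2,z,t)$ given by $x_i^N+y_i^N=1$ ($i=1,2$), $t^q-t=z^N$, $\lambda_1x_1^Nx_2^N=y_1^Ny_2^N$, $\lambda_2x_1^N=y_1^Nz^N$, $x_1x_2y_1y_2z\ne0$; $(\mathbb{F}_q^* )^5\times\mathbb{F}_q$ acts by multiplying $x_1,x_2,y_1,y_2,z$ and translating $t$, and $\chi(\xi_1,\dots,\xi_5,a)=\alpha_1(\xi_1)\alpha_2(\xi_2)\beta_1(\xi_3)\beta_2(\xi_4)\gamma(\xi_5)\psi(ca)$. $X_{\Phi_3,\boldsymbol\lambda}$: coordinates $(x,y,z_1,z_2,t_1,t_2)$ given by $x^N+y^N=1$, $t_i^q-t_i=z_i^N$ ($i=1,2$), $\lambda_1x^N=y^Nz_1^N$, $\lambda_2=z_1^Nz_2^N$, $xyz_1z_2\ne0$; $(\mathbb{F}_q^* )^4\times\mathbb{F}_q^2$ acts by multiplying $x,y,z_1,z_2$ and translating $t_1,t_2$, characters in the same order. For a variety $X$ over $\mathbb{F}_q$ with action of a finite abelian group $G$ and a character $\chi$, $N(X;\chi)=\frac1{\#G}\sum_{g\in G}\chi(g)\#\{P\in X(\overline{\mathbb{F}}_q):\mathrm{Frob}(P)=g\cdot P\}$. *)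

(* Defs.v *)
From HB Require Import structures.
From mathcomp Require Import all_boot all_order all_fingroup all_algebra.
From mathcomp Require Import all_solvable all_field all_character.
From mathcomp Require Import finmap.
From mathcomp Require Import boolp classical_sets cardinality.

Set Implicit Arguments.
Unset Strict Implicit.
Unset Printing Implicit Defensive.

Import GRing.Theory.
Local Open Scope ring_scope.

(* Complex characters take values in roots of unity, hence in algC.
   Multiplicative characters of F are the linear characters among the class
   functions on the full unit group; additive ones are the linear characters of
   the additive group underlying the finZmodType F. *)
Notation mulCF F := 'CF([set: {unit F}]%G).
Notation addCF F := 'CF([set: F]%G).

Section Characters.
Variable F : finFieldType.
Implicit Types (eta alpha beta gamma delta mu nu : mulCF F) (psi : addCF F).

Definition ext0 eta (x : F) : algC :=
  if insub x is Some u then eta (u : {unit F}) else 0.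

Definition twist psi (a : F) : F -> algC := fun x => psi (a * x).

Definition qC : algC := #|F|%:R.

Definition gauss psi eta : algC :=
  - \sum_(x : {unit F}) psi (val x) * eta x.

Definition gauss0 psi eta : algC :=
  qC ^+ (eta == 1)%R * gauss psi eta.

Definition jacobi eta1 eta2 : algC :=
  - \sum_(x1 : {unit F}) \sum_(x2 : {unit F} | val x1 + val x2 == 1)
      eta1 x1 * eta2 x2.

Definition poch psi alpha nu : algC :=
  gauss psi (alpha * nu) / gauss psi alpha.

Definition poch0 psi alpha nu : algC :=
  gauss0 psi (alpha * nu) / gauss0 psi alpha.

(* The unit group is abelian, so irr enumerates exactly its linear characters,
   each once. *)
Definition Phi1 psi alpha beta gamma delta1 delta2 (l1 l2 : F) : algC :=
  ((1 - qC) ^+ 2)^-1 *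
  \sum_(mu <- irr [set: {unit F}]%G) \sum_(nu <- irr [set: {unit F}]%G)
    (poch psi alpha (mu * nu) * poch psi beta mu)
    / (poch0 psi gamma (mu * nu) * poch0 psi delta1 mu * poch0 psi delta2 nu)
    * ext0 mu l1 * ext0 nu l2.

Definition Phi3 psi beta gamma delta1 delta2 (l1 l2 : F) : algC :=
  ((1 - qC) ^+ 2)^-1 *
  \sum_(mu <- irr [set: {unit F}]%G) \sum_(nu <- irr [set: {unit F}]%G)
    poch psi beta mu
    / (poch0 psi gamma (mu * nu) * poch0 psi delta1 mu * poch0 psi delta2 nu)
    * ext0 mu l1 * ext0 nu l2.

End Characters.

Section PointCounts.
Variables (F : finFieldType) (K : closedFieldType).

Definition frob n (P : 'rV[K]_n) : 'rV[K]_n := map_mx (fun x => x ^+ #|F|) P.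

(* X is the set of K-points of the variety. fset_set A is empty when A is
   infinite; for the two actions below, the points with frob P = act g P are
   always finitely many, their coordinates being roots of polynomials
   'X^q - xi 'X or 'X^q - 'X - a. *)
Definition Nchar n (X : set 'rV[K]_n) (gT : finGroupType)
    (act : gT -> 'rV[K]_n -> 'rV[K]_n) (chi : gT -> algC) : algC :=
  #|[set: gT]%G|%:R^-1 *
  \sum_(g : gT)
    chi g * #|` fset_set [set P | X P /\ frob P = act g P]%classic |%:R.

End PointCounts.

Section Varieties.
Variables (F : finFieldType) (K : closedFieldType) (iota : {rmorphism F -> K}).

Let N := #|F|.-1.

(* Coordinates (x1, x2, y1, y2, z, t). *)
Definition X_Phi1 (l1 l2 : F) : set 'rV[K]_6 :=
  [set P | let x1 := P 0 0 in let x2 := P 0 1 in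
           let y1 := P 0 2 in let y2 := P 0 3 in
           let z := P 0 4 in let t := P 0 5 in
     [/\ x1 ^+ N + y1 ^+ N = 1 /\ x2 ^+ N + y2 ^+ N = 1,
         t ^+ #|F| - t = z ^+ N,
         iota l1 * x1 ^+ N * x2 ^+ N = y1 ^+ N * y2 ^+ N,
         iota l2 * x1 ^+ N = y1 ^+ N * z ^+ N
       & x1 * x2 * y1 * y2 * z != 0] ]%classic.

Definition G_Phi1 : finGroupType :=
  ({unit F} * {unit F} * {unit F} * {unit F} * {unit F} * F)%type.

Definition act_Phi1 (g : G_Phi1) (P : 'rV[K]_6) : 'rV[K]_6 :=
  let: (xi1, xi2, xi3, xi4, xi5, a) := g in
  \row_(i < 6)
    [:: iota (val xi1) * P 0 0; iota (val xi2) * P 0 1;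
        iota (val xi3) * P 0 2; iota (val xi4) * P 0 3;
        iota (val xi5) * P 0 4; P 0 5 + iota a]`_i.

Definition chi_Phi1 (psi : addCF F) (alpha1 alpha2 beta1 beta2 gamma : mulCF F)
    (c : F) (g : G_Phi1) : algC :=
  let: (xi1, xi2, xi3, xi4, xi5, a) := g in
  alpha1 xi1 * alpha2 xi2 * beta1 xi3 * beta2 xi4 * gamma xi5 * twist psi c a.

(* Coordinates (x, y, z1, z2, t1, t2). *)
Definition X_Phi3 (l1 l2 : F) : set 'rV[K]_6 :=
  [set P | let x := P 0 0 in let y := P 0 1 in
           let z1 := P 0 2 in let z2 := P 0 3 in
           let t1 := P 0 4 in let t2 := P 0 5 in
     [/\ x ^+ N + y ^+ N = 1,
         t1 ^+ #|F| - t1 = z1 ^+ N /\ t2 ^+ #|F| - t2 = z2 ^+ N,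
         iota l1 * x ^+ N = y ^+ N * z1 ^+ N,
         iota l2 = z1 ^+ N * z2 ^+ N
       & x * y * z1 * z2 != 0] ]%classic.

Definition G_Phi3 : finGroupType :=
  ({unit F} * {unit F} * {unit F} * {unit F} * F * F)%type.

Definition act_Phi3 (g : G_Phi3) (P : 'rV[K]_6) : 'rV[K]_6 :=
  let: (xi1, xi2, xi3, xi4, a1, a2) := g in
  \row_(i < 6)
    [:: iota (val xi1) * P 0 0; iota (val xi2) * P 0 1;
        iota (val xi3) * P 0 2; iota (val xi4) * P 0 3;
        P 0 4 + iota a1; P 0 5 + iota a2]`_i.

Definition chi_Phi3 (psi : addCF F) (alpha beta gamma1 gamma2 : mulCF F)
    (c1 c2 : F) (g : G_Phi3) : algC :=
  let: (xi1, xi2, xi3, xi4, a1, a2) := g in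
  alpha xi1 * beta xi2 * gamma1 xi3 * gamma2 xi4
  * twist psi c1 a1 * twist psi c2 a2.

End Varieties.

(* Main.v *)
Require Import Defs.
From HB Require Import structures.
From mathcomp Require Import all_boot all_order all_fingroup all_algebra.
From mathcomp Require Import all_solvable all_field all_character.
From mathcomp Require Import finmap boolp classical_sets cardinality.
From mathcomp Require Import ring.
Set Implicit Arguments.
Unset Strict Implicit.
Unset Printing Implicit Defensive.

Import GRing.Theory Num.Theory.
Local Open Scope ring_scope.

(* A point [P] with [Frob P = g P] has [N]-th powers (and Artin-Schreier images)
   of its coordinates equal to the components of [g], so such points exist
   exactly when [g] itself satisfies the equations, and then they form a torsor
   under the group.  Hence [N(X; chi)] is the sum of [chi g] over those [g].
   Detecting the two multiplicative equations by sums over characters [mu, nu]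
   splits this into products of Jacobi and Gauss sums, and
   [j(a, b) g(ab) = g(a) g(b)] together with
   [g(eta) g0(eta^-1) = eta(-1) q] turns these into Pochhammer ratios; the signs
   [mu(-1)], [nu(-1)] each occur twice and cancel. *)

(** * Linear characters of a finite group and their orthogonality *)

Section LinearCharacters.
Variable gT : finGroupType.
Implicit Types phi eta : 'CF([set: gT]%G).

Lemma lin_charTM phi x y :
  phi \is a linear_char -> phi (x * y)%g = phi x * phi y.
Proof. by move=> lin_phi; rewrite lin_charM ?inE. Qed.

Lemma lin_charTV phi x : phi \is a linear_char -> phi x^-1%g = (phi x)^-1.
Proof. by move=> lin_phi; rewrite lin_charV ?inE. Qed.

Lemma lin_charT_neq0 phi x : phi \is a linear_char -> phi x != 0.
Proof. by move=> lin_phi; rewrite lin_char_neq0 ?inE. Qed.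

(** The inverse is taken in the ring of class functions, whose product is pointwise; evaluating
    [phi * phi^-1 = 1] at [x] identifies it with the conjugate character of the statement. *)
Lemma lin_charT_inv phi x : phi \is a linear_char -> phi^-1 x = (phi x)^-1.
Proof.
move=> lin_phi; apply: (mulfI (lin_charT_neq0 x lin_phi)).
have -> : phi x * phi^-1 x = (phi * phi^-1) x by rewrite cfunE.
rewrite mulrV ?lin_char_unitr // cfun1E inE.
by rewrite mulfV ?lin_charT_neq0.
Qed.

(** Translating the summation variable by some [u] with [phi u != 1] multiplies the sum by [phi u]
    without changing it. *)
Lemma sum_lin_charT_eq0 phi :
  phi \is a linear_char -> phi != 1 -> \sum_x phi x = 0.
Proof.
move=> lin_phi /eqP neq1.
have [u phi_u] : exists u, phi u != 1.
  apply/existsP; apply: contra_notT neq1; rewrite negb_exists => /forallP phi1.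
  by apply/cfunP=> u; rewrite cfun1E inE; have /negPn/eqP := phi1 u.
have : (1 - phi u) * \sum_x phi x = 0.
  rewrite mulrBl mul1r {1}(reindex_inj (mulgI u)) mulr_sumr.
  by rewrite -sumrB big1 // => x _; rewrite lin_charTM ?subrr.
by move/eqP; rewrite mulf_eq0 subr_eq0 eq_sym (negPf phi_u) => /eqP.
Qed.

(** All irreducible characters of an abelian group have degree 1, so their sum is the regular
    character. *)
Lemma sum_irr_abelian (x : gT) : abelian [set: gT] ->
  \sum_(mu <- irr [set: gT]%G) mu x = #|[set: gT]|%:R *+ (x == 1%g).
Proof.
move=> /char_abelianP lin_chi.
have := cfRegE [set: gT]%G x; rewrite cfReg_sum sum_cfunE big_tuple => <-.
by apply: eq_bigr => i _; rewrite cfunE lin_char1 ?lin_chi // mul1r.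
Qed.

End LinearCharacters.

(** * Gauss and Jacobi sums over a finite field *)

Section GaussSums.
Variables (F : finFieldType) (psi : addCF F).
Hypotheses (psi_char : psi \is a linear_char) (psi_neq1 : psi != 1).
Implicit Types (eta alpha beta mu : mulCF F).

Lemma unit_abelian : abelian [set: {unit F}].
Proof. by apply/centsP=> x _ y _; apply: val_inj; rewrite /= mulrC. Qed.

Lemma irr_lin_char mu : mu \in irr [set: {unit F}]%G -> mu \is a linear_char.
Proof. case/irrP=> i ->; exact: (char_abelianP [set: {unit F}]%G unit_abelian i). Qed.

Lemma card_unit_natr : #|[set: {unit F}]|%:R = qC F - 1.
Proof.
rewrite card_finField_unit /qC -[in RHS](prednK (_ : 0 < #|F|)%N).
  by rewrite -natr1 addrK.
by apply/card_gt0P; exists 0.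
Qed.

Lemma qC_neq0 : qC F != 0.
Proof. by rewrite pnatr_eq0 -lt0n; apply/card_gt0P; exists 0. Qed.

Lemma psiD x y : psi (x + y) = psi x * psi y.
Proof. exact: (lin_charTM x y psi_char). Qed.

Lemma psi0 : psi 0 = 1.
Proof. exact: (lin_char1 psi_char). Qed.

Lemma sum_field_units (R : nmodType) (f : F -> R) :
  \sum_x f x = f 0 + \sum_(u : {unit F}) f (val u).
Proof.
rewrite (bigD1 0) //=; congr (_ + _).
rewrite (reindex_omap (fun u : {unit F} => val u) insub) /=.
  by apply: eq_bigl => u; rewrite valK eqxx andbT -unitfE (valP u).
by move=> x x_neq0; rewrite insubT ?unitfE.
Qed.

Definition unitN1 : {unit F} := FinRing.unit F (unitrN1 F).

Lemma lin_char_unitN1_sqr mu : mu \is a linear_char -> mu unitN1 * mu unitN1 = 1.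
Proof.
move=> lin_mu; rewrite -lin_charTM // -(lin_char1 lin_mu); congr (mu _).
by apply: val_inj; rewrite /= mulrNN mulr1.
Qed.

Lemma sum_psi_mul c : \sum_x psi (c * x) = qC F *+ (c == 0).
Proof.
have [-> | c_neq0] := eqVneq c 0.
  by under eq_bigr do rewrite mul0r psi0; rewrite sumr_const.
have /= := sum_lin_charT_eq0 psi_char psi_neq1.
by rewrite (reindex_inj (mulfI c_neq0)).
Qed.

Lemma sum_psi_mul_unit c :
  \sum_(x : {unit F}) psi (c * val x) = qC F *+ (c == 0) - 1.
Proof. by rewrite -sum_psi_mul sum_field_units mulr0 psi0 [1 + _]addrC addrK. Qed.

Lemma gauss1 : gauss psi 1 = 1.
Proof.
rewrite /gauss (eq_bigr (fun x : {unit F} => psi (1 * val x))) => [|x _].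
  by rewrite sum_psi_mul_unit oner_eq0 mulr0n sub0r opprK.
by rewrite cfun1E inE mulr1 mul1r.
Qed.

(** Substituting [x = u y] in the double sum leaves [eta u * psi ((u + 1) * y)]. The sum over [y] is
    [q - 1] for [u = -1] and [-1] otherwise; the constant [-1] is killed by orthogonality. *)
Lemma gauss_mul_gaussV eta : eta \is a linear_char -> eta != 1 ->
  gauss psi eta * gauss psi eta^-1 = eta unitN1 * qC F.
Proof.
move=> lin_eta neq1; rewrite /gauss mulrNN mulr_sumr.
transitivity (\sum_(y : {unit F}) \sum_(u : {unit F})
                eta u * psi ((val u + 1) * val y)).
  apply: eq_bigr => y _; rewrite mulr_suml (reindex_inj (mulIg y)).
  apply: eq_bigr => u _; rewrite lin_charTM // lin_charT_inv // mulrDl psiD mul1r.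
  rewrite /=; field; exact: lin_charT_neq0.
rewrite exchange_big /=.
rewrite (eq_bigr (fun u => eta u * (qC F *+ (u == unitN1)) - eta u)) => [|u _].
  rewrite sumrB sum_lin_charT_eq0 // subr0 (bigD1 unitN1) //= eqxx mulr1n.
  by rewrite big1 ?addr0 // => u /negPf->; rewrite mulr0.
rewrite -mulr_sumr sum_psi_mul_unit mulrBr mulr1; congr (_ * (_ *+ nat_of_bool _) - _).
by rewrite addr_eq0 -val_eqE.
Qed.

Lemma gauss0_nontrivial eta : eta != 1 -> gauss0 psi eta = gauss psi eta.
Proof. by move/negPf=> neq1; rewrite /gauss0 neq1 mul1r. Qed.

(** The factor [q] in [gauss0] at the trivial character makes up for [g(1) = 1], so that one formula
    covers every character. *)
Lemma gauss_reflection eta : eta \is a linear_char ->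
  gauss psi eta * gauss0 psi eta^-1 = eta unitN1 * qC F.
Proof.
move=> lin_eta; have [-> | neq1] := eqVneq eta 1.
  by rewrite invr1 /gauss0 eqxx gauss1 cfun1E inE expr1 mulr1 !mul1r.
rewrite gauss0_nontrivial ?gauss_mul_gaussV //.
by apply: contraNneq neq1 => eq1; rewrite -[eta]invrK eq1 invr1.
Qed.

Lemma gauss_neq0 eta : eta \is a linear_char -> gauss psi eta != 0.
Proof.
move=> lin_eta; have := mulf_neq0 (lin_charT_neq0 unitN1 lin_eta) qC_neq0.
by rewrite -gauss_reflection // mulf_eq0 negb_or => /andP[].
Qed.

Lemma gauss0_neq0 eta : eta \is a linear_char -> gauss0 psi eta != 0.
Proof. by move=> lin_eta; rewrite mulf_neq0 ?gauss_neq0 ?expf_neq0 ?qC_neq0. Qed.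

(** Replacing [x] by [c^-1 x] absorbs the twist of [psi]. *)
Lemma gauss_twist eta (c : {unit F}) : eta \is a linear_char ->
  \sum_(x : {unit F}) eta x * psi (val c * val x) = - gauss psi eta * eta^-1 c.
Proof.
move=> lin_eta; rewrite opprK mulr_suml (reindex_inj (mulgI c^-1%g)).
apply: eq_bigr => x _; rewrite lin_charTM // lin_charTV // lin_charT_inv //.
rewrite -FinRing.val_unitM mulKVg; ring.
Qed.

Lemma gauss_mul alpha beta :
    alpha \is a linear_char -> beta \is a linear_char -> alpha * beta != 1 ->
  gauss psi alpha * gauss psi beta = gauss psi (alpha * beta) * jacobi alpha beta.
Proof.
move=> lin_a lin_b neq1.
have lin_ab : alpha * beta \is a linear_char by rewrite rpredM.
(* The diagonal [x + y = 0] contributes [beta (-1)] times the sum of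
   [alpha * beta], which vanishes. *)
rewrite /gauss /jacobi !mulrNN mulr_suml.
under eq_bigr do rewrite mulr_sumr.
(* Group the product of Gauss sums by the value [s = x + y]. For [s != 0], scaling [x] and [y] by
   [s] gives [h s = (alpha * beta) s * h 1], and [h 1] is the opposite of the Jacobi sum. *)
pose h (s : F) : algC := \sum_(x : {unit F}) \sum_(y : {unit F} | val x + val y == s)
  alpha x * beta y.
transitivity (\sum_s psi s * h s).
  rewrite /h; under [RHS]eq_bigr do rewrite mulr_sumr.
  rewrite [RHS]exchange_big; apply: eq_bigr => x _ /=.
  under [RHS]eq_bigr do rewrite mulr_sumr big_mkcond.
  rewrite [RHS]exchange_big; apply: eq_bigr => y _ /=.
  rewrite -big_mkcond (big_pred1 (val x + val y)).
    rewrite psiD; ring.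
  by move=> s; rewrite /= eq_sym.
rewrite sum_field_units psi0 mul1r [h 0](_ : _ = 0) ?add0r.
  rewrite mulr_suml; apply: eq_bigr => s _.
  rewrite -mulrA; congr (_ * _); rewrite /h (reindex_inj (mulgI s)) mulr_sumr.
  apply: eq_bigr => x _; rewrite mulr_sumr (reindex_inj (mulgI s)) /=.
  apply: eq_big => [y | y _].
    rewrite -mulrDr -[X in _ == X]mulr1 (inj_eq (mulfI _)) //.
    by rewrite -unitfE (valP s).
  rewrite !lin_charTM // cfunE; ring.
rewrite /h; transitivity (\sum_x beta unitN1 * (alpha * beta) x).
  apply: eq_bigr => x _; rewrite (big_pred1 (unitN1 * x)%g) => [|y].
    rewrite lin_charTM // cfunE; ring.
  by rewrite /= addrC addr_eq0 -val_eqE /= mulN1r.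
by rewrite -mulr_sumr sum_lin_charT_eq0 ?mulr0.
Qed.

(** Reflection at [beta] and at [beta * mu^-1] produces the same [q]. Comparing the two moves the
    Gauss sums into the denominator as [gauss0], with sign [mu^-1(-1) = mu(-1)]. No case distinction
    on trivial characters is left. *)
Lemma gauss_mulV beta mu : beta \is a linear_char -> mu \is a linear_char ->
  gauss psi (beta * mu^-1) = gauss psi beta * mu unitN1 / poch0 psi beta^-1 mu.
Proof.
move=> lin_b lin_m.
have lin_bV : beta^-1 \is a linear_char by rewrite rpredV.
have lin_bm : beta * mu^-1 \is a linear_char by rewrite rpredM ?rpredV.
have lin_bVm : beta^-1 * mu \is a linear_char by rewrite rpredM.
have Eb := gauss_reflection lin_b; have := gauss_reflection lin_bm.
rewrite invrM ?unitrV ?lin_char_unitr // invrK mulrC (mulrC mu) => Ebm.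
rewrite /poch0 invfM invrK -mulrA (mulrA _ _ (gauss0 _ _)).
apply: (mulfI (gauss0_neq0 lin_bVm)); rewrite Ebm.
rewrite cfunE lin_charT_inv //.
transitivity (gauss psi beta * gauss0 psi beta^-1 * mu unitN1); last first.
  field; exact: gauss0_neq0.
rewrite Eb -[in LHS](mulr1 (_^-1)) -(lin_char_unitN1_sqr lin_m).
field; exact: lin_charT_neq0.
Qed.

(** The shift by [mu] leaves the product [alpha * beta] unchanged, so both Jacobi sums are quotients
    by the same nonzero [g(alpha * beta)]; [gauss_mulV] then handles the factor
    [g(beta * mu^-1)]. *)
Lemma jacobi_shift alpha beta mu :
    alpha \is a linear_char -> beta \is a linear_char -> mu \is a linear_char ->
    alpha * beta != 1 ->
  jacobi (alpha * mu) (beta * mu^-1)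
    = jacobi alpha beta * poch psi alpha mu * mu unitN1 / poch0 psi beta^-1 mu.
Proof.
move=> lin_a lin_b lin_m neq1.
have lin_ab : alpha * beta \is a linear_char by rewrite rpredM.
have Eab : alpha * mu * (beta * mu^-1) = alpha * beta.
  by rewrite mulrACA mulrV ?mulr1 ?lin_char_unitr.
apply: (mulfI (gauss_neq0 lin_ab)); rewrite -{1}Eab -gauss_mul ?Eab ?rpredM ?rpredV //.
rewrite gauss_mulV // !mulrA -gauss_mul // /poch.
move: (poch0 _ _ _)^-1 => p0V; field; exact: gauss_neq0.
Qed.

End GaussSums.

(** * Kummer and Artin-Schreier torsors, and counting twisted Frobenius fixed points *)

Section TwistedFrobenius.
Variables (F : finFieldType) (K : closedFieldType) (iota : {rmorphism F -> K}).

Lemma card_field_pred : #|F| = #|F|.-1.+1.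
Proof. by rewrite prednK //; apply/card_gt0P; exists 0. Qed.

Lemma card_field_pred_gt0 : (0 < #|F|.-1)%N.
Proof. by rewrite -ltnS -card_field_pred finNzRing_gt1. Qed.

(** The polynomial [X^q - X] is the product of the [X - a] over [a] in [F], so its roots in [K] are
    the images of [F]. *)
Lemma frob_fixed (x : K) : x ^+ #|F| = x -> exists a, x = iota a.
Proof.
move=> xq; have : root (map_poly iota ('X^#|F| - 'X)) x.
  by rewrite rootE rmorphB rmorphXn /= map_polyX !hornerE xq subrr.
rewrite finField_genPoly rmorph_prod /= rootE horner_prod.
case/prodf_eq0 => a _; rewrite rmorphB /= map_polyX map_polyC !hornerE subr_eq0.
by move/eqP=> ->; exists a.
Qed.

Lemma iota_unit_neq0 (u : {unit F}) : iota (val u) != 0.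
Proof. by rewrite fmorph_eq0 -unitfE (valP u). Qed.

Lemma iota_expr_pred (u : {unit F}) : iota (val u) ^+ #|F|.-1 = 1.
Proof.
rewrite -rmorphXn /= -(rmorph1 iota); congr (iota _).
have u_neq0 : val u != 0 by rewrite -unitfE (valP u).
by apply: (mulfI u_neq0); rewrite -exprS -card_field_pred expf_card mulr1.
Qed.

Lemma exists_root (p : {poly K}) : (1 < size p)%N -> exists x, root p x.
Proof. by move=> p_gt1; apply/closed_rootP; rewrite gtn_eqF. Qed.

Lemma kummer_neq0 (x : K) (u : {unit F}) :
  x ^+ #|F|.-1 = iota (val u) -> x != 0.
Proof.
move=> xu; apply: contraNneq (iota_unit_neq0 u) => x0.
by rewrite -xu x0 expr0n gtn_eqF ?card_field_pred_gt0.
Qed.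

Lemma kummer_frob (x : K) (u : {unit F}) : x != 0 ->
  x ^+ #|F| = iota (val u) * x <-> x ^+ #|F|.-1 = iota (val u).
Proof.
move=> x_neq0; rewrite card_field_pred exprSr /=; split=> [|->] //.
exact: (mulIf x_neq0).
Qed.

(** The ratio of two roots of [X^(q-1) = u] has [(q-1)]-th power 1, hence is fixed by Frobenius and
    comes from a unit of [F]. *)
Lemma kummer_torsor (u : {unit F}) : exists2 x0 : K, x0 != 0 &
  forall x, x ^+ #|F|.-1 = iota (val u) <-> exists v : {unit F}, x = iota (val v) * x0.
Proof.
have [|x0] := @exists_root ('X^(#|F|.-1) - (iota (val u))%:P).
  by rewrite size_XnsubC ?card_field_pred_gt0 // ltnS card_field_pred_gt0.
rewrite rootE !hornerE subr_eq0 => /eqP x0u.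
have x0_neq0 := kummer_neq0 x0u.
exists x0 => // x; split=> [xu | [v ->]]; last first.
  by rewrite exprMn iota_expr_pred mul1r.
have [|a xa] := @frob_fixed (x / x0).
  rewrite card_field_pred exprS expr_div_n xu x0u divff ?iota_unit_neq0 //.
  by rewrite mulr1.
have a_unit : a \is a GRing.unit.
  rewrite unitfE -(fmorph_eq0 iota) -xa mulf_neq0 ?invr_neq0 //.
  exact: kummer_neq0 xu.
by exists (FinRing.unit F a_unit); rewrite /= -xa divfK.
Qed.

(** The cardinal [q] is a power of the characteristic, which [iota] makes common to [F] and [K]. *)
Lemma frobD (x y : K) : (x + y) ^+ #|F| = x ^+ #|F| + y ^+ #|F|.
Proof.
have [p p_pr charFp] := finPcharP F.
have charKp : p \in [pchar K] by rewrite (rmorph_pchar iota).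
apply: exprDn_pchar; rewrite (eq_pnat _ (pcharf_eq charKp)) -cardsT.
exact: abelem_pgroup (fin_ring_pchar_abelem charFp).
Qed.

(** Additive analogue of [kummer_torsor]: the difference of two roots of [T^q - T = a] is fixed by
    Frobenius. *)
Lemma artin_schreier_torsor (a : F) : exists t0 : K,
  forall t, t ^+ #|F| - t = iota a <-> exists b, t = t0 + iota b.
Proof.
have [|t0] := @exists_root ('X^#|F| - 'X - (iota a)%:P).
  rewrite -addrA -opprD size_polyDl ?size_polyXn ?ltnS ?finNzRing_gt1 //.
    by rewrite ltnW // finNzRing_gt1.
  by rewrite size_polyN size_XaddC finNzRing_gt1.
rewrite rootE !hornerE subr_eq0 => /eqP t0a.
exists t0 => t; split=> [ta | [b ->]]; last first.
  rewrite frobD -rmorphXn /= expf_card -t0a; ring.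
have [|b tb] := @frob_fixed (t - t0); last by exists b; rewrite -tb addrC subrK.
have := frobD (t - t0) t0; rewrite subrK => frob_t.
apply/eqP; rewrite -subr_eq0; apply/eqP.
transitivity (t ^+ #|F| - t - (t0 ^+ #|F| - t0)); last by rewrite ta t0a subrr.
rewrite frob_t; ring.
Qed.


Lemma eq_row6 (P Q : 'rV[K]_6) :
  [/\ P 0 0 = Q 0 0, P 0 1 = Q 0 1 & P 0 2 = Q 0 2] ->
  [/\ P 0 3 = Q 0 3, P 0 4 = Q 0 4 & P 0 5 = Q 0 5] -> P = Q.
Proof.
move=> [e0 e1 e2] [e3 e4 e5]; apply/rowP; case=> [[|[|[|[|[|[|//]]]]]] lt_i].
- by rewrite (_ : Ordinal lt_i = 0) //; apply: val_inj.
- by rewrite (_ : Ordinal lt_i = 1) //; apply: val_inj.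
- by rewrite (_ : Ordinal lt_i = 2) //; apply: val_inj.
- by rewrite (_ : Ordinal lt_i = 3) //; apply: val_inj.
- by rewrite (_ : Ordinal lt_i = 4) //; apply: val_inj.
- by rewrite (_ : Ordinal lt_i = 5) //; apply: val_inj.
Qed.

(* When [gT] acts simply transitively on the twisted Frobenius fixed points of
   every admissible [g], their number cancels the normalisation of [Nchar]. *)
Lemma Nchar_torsor n (X : set 'rV[K]_n) (gT : finGroupType)
    (act : gT -> 'rV[K]_n -> 'rV[K]_n) (chi : gT -> algC) (C : pred gT) :
    (forall g P, X P -> frob F P = act g P -> C g) ->
    (forall g, C g -> exists2 P0, injective (act^~ P0) &
       forall P, X P /\ frob F P = act g P <-> exists h, P = act h P0) ->
  Nchar F X act chi = \sum_(g | C g) chi g.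
Proof.
move=> XC torsor; rewrite /Nchar mulr_sumr [RHS]big_mkcond.
have card_neq0 : #|[set: gT]%G|%:R != 0 :> algC.
  by rewrite pnatr_eq0 -lt0n cardG_gt0.
apply: eq_bigr => g _; case: ifPn => [Cg | nCg]; last first.
  rewrite (_ : mkset _ = set0%classic) ?fset_set0 ?cardfs0 ?mulr0 //.
  by rewrite -subset0 => P [XP /(XC _ _ XP)]; apply/negP.
have [P0 act_inj orbitP] := torsor g Cg.
set A := [fset act h P0 | h in [set: gT]]%fset.
(* Identifying the set of points with the finite orbit [A] ensures that [fset_set] does not return
   its default empty value; injectivity of the orbit map then gives its cardinal. *)
rewrite (_ : mkset _ = [set` A]%classic); last first.
  apply/seteqP; split=> P /=.
    by move=> /orbitP[h ->]; apply/imfsetP; exists h; rewrite ?inE.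
  by case/imfsetP=> h _ ->; apply/orbitP; exists h.
rewrite set_fsetK card_imfset //= -cardE mulrCA mulVf ?mulr1 //.
Qed.

End TwistedFrobenius.

(** * Reduction of the point count on [X_Phi1] to a sum over group elements *)

Section Phi1Points.
Variables (F : finFieldType) (K : closedFieldType) (iota : {rmorphism F -> K}).
Variables l1 l2 : F.

(** The equations of [X_Phi1] with each [N]-th power replaced by the matching unit, and [t^q - t] by
    [a]. *)
Definition cond_Phi1 (g : G_Phi1 F) : bool :=
  let: (xi1, xi2, xi3, xi4, xi5, a) := g in
  [&& val xi1 + val xi3 == 1, val xi2 + val xi4 == 1, a == val xi5,
      l1 * val xi1 * val xi2 == val xi3 * val xi4
    & l2 * val xi1 == val xi3 * val xi5].

Lemma mulf5_neq0 (x1 x2 x3 x4 x5 : K) : x1 * x2 * x3 * x4 * x5 != 0 ->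
  [/\ x1 != 0, x2 != 0, x3 != 0, x4 != 0 & x5 != 0].
Proof. by rewrite !mulf_eq0 !negb_or => /andP[/andP[/andP[/andP[-> ->] ->] ->] ->]. Qed.

(** For a nonzero coordinate [x], the Frobenius condition [x^q = xi x] means [x^N = xi]; for [t] it
    reads [t^q - t = a]. The variety only involves these quantities, so its equations become
    conditions on [g]. *)
Lemma X_Phi1_frobP (g : G_Phi1 F) (P : 'rV[K]_6) :
  X_Phi1 iota l1 l2 P /\ frob F P = act_Phi1 iota g P <->
  let: (xi1, xi2, xi3, xi4, xi5, a) := g in
  cond_Phi1 g /\
  [/\ P 0 0 ^+ #|F|.-1 = iota (val xi1), P 0 1 ^+ #|F|.-1 = iota (val xi2)
    & P 0 2 ^+ #|F|.-1 = iota (val xi3)] /\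
  [/\ P 0 3 ^+ #|F|.-1 = iota (val xi4), P 0 4 ^+ #|F|.-1 = iota (val xi5)
    & P 0 5 ^+ #|F| - P 0 5 = iota a].
Proof.
case: g => [[[[[xi1 xi2] xi3] xi4] xi5] a]; split.
  case=> [[[e1 e2] e3 e4 e5 /mulf5_neq0[x1_neq0 x2_neq0 y1_neq0 y2_neq0 z_neq0]]].
  move/rowP=> frobP.
  have := frobP 0; rewrite !mxE /= => /(kummer_frob iota _ x1_neq0) Ex1.
  have := frobP 1; rewrite !mxE /= => /(kummer_frob iota _ x2_neq0) Ex2.
  have := frobP 2; rewrite !mxE /= => /(kummer_frob iota _ y1_neq0) Ey1.
  have := frobP 3; rewrite !mxE /= => /(kummer_frob iota _ y2_neq0) Ey2.
  have := frobP 4; rewrite !mxE /= => /(kummer_frob iota _ z_neq0) Ez.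
  have := frobP 5; rewrite !mxE /= => Et.
  have {}Et : P 0 5 ^+ #|F| - P 0 5 = iota a by rewrite Et addrC addKr.
  (* Both sides of each equation now lie in the image of [iota], whose injectivity brings the
     equations down to [F]. *)
  rewrite Ex1 Ex2 Ey1 Ey2 Ez Et -!rmorphM -?rmorphD in e1 e2 e3 e4 e5.
  split=> //; apply/and5P; split; apply/eqP; apply: (fmorph_inj iota) => //.
  - by rewrite e1 rmorph1.
  - by rewrite e2 rmorph1.
case=> /and5P[/eqP e1 /eqP e2 /eqP e3 /eqP e4 /eqP e5].
case=> [[Ex1 Ex2 Ey1] [Ey2 Ez Et]].
(* The open condition is automatic here, the [N]-th powers being images of units. *)
have x1_neq0 := kummer_neq0 Ex1; have x2_neq0 := kummer_neq0 Ex2.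
have y1_neq0 := kummer_neq0 Ey1; have y2_neq0 := kummer_neq0 Ey2.
have z_neq0 := kummer_neq0 Ez.
split.
  rewrite /X_Phi1 /= Ex1 Ex2 Ey1 Ey2 Ez Et -!rmorphM -!rmorphD e1 e2 e3 e4 e5 rmorph1.
  by rewrite !mulf_neq0.
apply: eq_row6; split; rewrite !mxE /=; try exact/kummer_frob.
by rewrite -Et addrC subrK.
Qed.

(** For admissible [g] the solutions form a product of five Kummer torsors and one Artin-Schreier
    torsor; a base point collects one root of each. *)
Lemma Nchar_Phi1 (chi : G_Phi1 F -> algC) :
  Nchar F (X_Phi1 iota l1 l2) (act_Phi1 iota) chi = \sum_(g | cond_Phi1 g) chi g.
Proof.
apply: Nchar_torsor => [g P XP frobP | g Cg].
  have /X_Phi1_frobP := conj XP frobP.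
  by case: g {frobP} => [[[[[xi1 xi2] xi3] xi4] xi5] a] [].
move: Cg; case: g => [[[[[xi1 xi2] xi3] xi4] xi5] a] Cg.
have [x1 x1_neq0 x1P] := kummer_torsor iota xi1.
have [x2 x2_neq0 x2P] := kummer_torsor iota xi2.
have [y1 y1_neq0 y1P] := kummer_torsor iota xi3.
have [y2 y2_neq0 y2P] := kummer_torsor iota xi4.
have [z z_neq0 zP] := kummer_torsor iota xi5.
have [t tP] := artin_schreier_torsor iota a.
exists (\row_(i < 6) [:: x1; x2; y1; y2; z; t]`_i).
  move=> [[[[[v1 v2] v3] v4] v5] b] [[[[[w1 w2] w3] w4] w5] d] /rowP eq_act.
  have := eq_act 0; rewrite !mxE /= => /(mulIf x1_neq0)/fmorph_inj/val_inj->.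
  have := eq_act 1; rewrite !mxE /= => /(mulIf x2_neq0)/fmorph_inj/val_inj->.
  have := eq_act 2; rewrite !mxE /= => /(mulIf y1_neq0)/fmorph_inj/val_inj->.
  have := eq_act 3; rewrite !mxE /= => /(mulIf y2_neq0)/fmorph_inj/val_inj->.
  have := eq_act 4; rewrite !mxE /= => /(mulIf z_neq0)/fmorph_inj/val_inj->.
  by have := eq_act 5; rewrite !mxE /= => /addrI/fmorph_inj->.
move=> P; split.
  case/X_Phi1_frobP=> _ [[/x1P[v1 e1] /x2P[v2 e2] /y1P[v3 e3]]].
  move=> [/y2P[v4 e4] /zP[v5 e5] /tP[b e6]]; exists (v1, v2, v3, v4, v5, b).
  by apply: eq_row6; split; rewrite !mxE.
case=> [[[[[[v1 v2] v3] v4] v5] b] ->]; apply/X_Phi1_frobP; split=> //.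
rewrite !mxE /=; split; split.
- by apply/x1P; exists v1.
- by apply/x2P; exists v2.
- by apply/y1P; exists v3.
- by apply/y2P; exists v4.
- by apply/zP; exists v5.
- by apply/tP; exists b.
Qed.

End Phi1Points.

(** * The same reduction for [X_Phi3], with two Artin-Schreier coordinates *)

Section Phi3Points.
Variables (F : finFieldType) (K : closedFieldType) (iota : {rmorphism F -> K}).
Variables l1 l2 : F.

Definition cond_Phi3 (g : G_Phi3 F) : bool :=
  let: (xi1, xi2, xi3, xi4, a1, a2) := g in
  [&& val xi1 + val xi2 == 1, a1 == val xi3, a2 == val xi4,
      l1 * val xi1 == val xi2 * val xi3 & l2 == val xi3 * val xi4].

Lemma X_Phi3_frobP (g : G_Phi3 F) (P : 'rV[K]_6) :
  X_Phi3 iota l1 l2 P /\ frob F P = act_Phi3 iota g P <->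
  let: (xi1, xi2, xi3, xi4, a1, a2) := g in
  cond_Phi3 g /\
  [/\ P 0 0 ^+ #|F|.-1 = iota (val xi1), P 0 1 ^+ #|F|.-1 = iota (val xi2)
    & P 0 2 ^+ #|F|.-1 = iota (val xi3)] /\
  [/\ P 0 3 ^+ #|F|.-1 = iota (val xi4), P 0 4 ^+ #|F| - P 0 4 = iota a1
    & P 0 5 ^+ #|F| - P 0 5 = iota a2].
Proof.
case: g => [[[[[xi1 xi2] xi3] xi4] a1] a2]; split.
  case=> [[e1 [e2 e3] e4 e5]].
  rewrite !mulf_eq0 !negb_or => /andP[/andP[/andP[x_neq0 y_neq0] z1_neq0] z2_neq0].
  move/rowP=> frobP.
  have := frobP 0; rewrite !mxE /= => /(kummer_frob iota _ x_neq0) Ex.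
  have := frobP 1; rewrite !mxE /= => /(kummer_frob iota _ y_neq0) Ey.
  have := frobP 2; rewrite !mxE /= => /(kummer_frob iota _ z1_neq0) Ez1.
  have := frobP 3; rewrite !mxE /= => /(kummer_frob iota _ z2_neq0) Ez2.
  have := frobP 4; rewrite !mxE /= => Et1.
  have {}Et1 : P 0 4 ^+ #|F| - P 0 4 = iota a1 by rewrite Et1 addrC addKr.
  have := frobP 5; rewrite !mxE /= => Et2.
  have {}Et2 : P 0 5 ^+ #|F| - P 0 5 = iota a2 by rewrite Et2 addrC addKr.
  rewrite Ex Ey Ez1 Ez2 Et1 Et2 -!rmorphM -?rmorphD in e1 e2 e3 e4 e5.
  split=> //; apply/and5P; split; apply/eqP; apply: (fmorph_inj iota) => //.
  by rewrite e1 rmorph1.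
case=> /and5P[/eqP e1 /eqP e2 /eqP e3 /eqP e4 /eqP e5].
case=> [[Ex Ey Ez1] [Ez2 Et1 Et2]].
have x_neq0 := kummer_neq0 Ex; have y_neq0 := kummer_neq0 Ey.
have z1_neq0 := kummer_neq0 Ez1; have z2_neq0 := kummer_neq0 Ez2.
split.
  rewrite /X_Phi3 /= Ex Ey Ez1 Ez2 Et1 Et2 -!rmorphM -!rmorphD e1 e2 e3 e4 -e5 rmorph1.
  by rewrite !mulf_neq0.
apply: eq_row6; split; rewrite !mxE /=; try exact/kummer_frob.
  by rewrite -Et1 addrC subrK.
by rewrite -Et2 addrC subrK.
Qed.

Lemma Nchar_Phi3 (chi : G_Phi3 F -> algC) :
  Nchar F (X_Phi3 iota l1 l2) (act_Phi3 iota) chi = \sum_(g | cond_Phi3 g) chi g.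
Proof.
apply: Nchar_torsor => [g P XP frobP | g Cg].
  have /X_Phi3_frobP := conj XP frobP.
  by case: g {frobP} => [[[[[xi1 xi2] xi3] xi4] a1] a2] [].
move: Cg; case: g => [[[[[xi1 xi2] xi3] xi4] a1] a2] Cg.
have [x x_neq0 xP] := kummer_torsor iota xi1.
have [y y_neq0 yP] := kummer_torsor iota xi2.
have [z1 z1_neq0 z1P] := kummer_torsor iota xi3.
have [z2 z2_neq0 z2P] := kummer_torsor iota xi4.
have [t1 t1P] := artin_schreier_torsor iota a1.
have [t2 t2P] := artin_schreier_torsor iota a2.
exists (\row_(i < 6) [:: x; y; z1; z2; t1; t2]`_i).
  move=> [[[[[v1 v2] v3] v4] b1] b2] [[[[[w1 w2] w3] w4] d1] d2] /rowP eq_act.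
  have := eq_act 0; rewrite !mxE /= => /(mulIf x_neq0)/fmorph_inj/val_inj->.
  have := eq_act 1; rewrite !mxE /= => /(mulIf y_neq0)/fmorph_inj/val_inj->.
  have := eq_act 2; rewrite !mxE /= => /(mulIf z1_neq0)/fmorph_inj/val_inj->.
  have := eq_act 3; rewrite !mxE /= => /(mulIf z2_neq0)/fmorph_inj/val_inj->.
  have := eq_act 4; rewrite !mxE /= => /addrI/fmorph_inj->.
  by have := eq_act 5; rewrite !mxE /= => /addrI/fmorph_inj->.
move=> P; split.
  case/X_Phi3_frobP=> _ [[/xP[v1 e1] /yP[v2 e2] /z1P[v3 e3]]].
  move=> [/z2P[v4 e4] /t1P[b1 e5] /t2P[b2 e6]]; exists (v1, v2, v3, v4, b1, b2).
  by apply: eq_row6; split; rewrite !mxE.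
case=> [[[[[[v1 v2] v3] v4] b1] b2] ->]; apply/X_Phi3_frobP; split=> //.
rewrite !mxE /=; split; split.
- by apply/xP; exists v1.
- by apply/yP; exists v2.
- by apply/z1P; exists v3.
- by apply/z2P; exists v4.
- by apply/t1P; exists b1.
- by apply/t2P; exists b2.
Qed.

End Phi3Points.

(** * Evaluation of the resulting character sums *)

Section CharacterSums.
Variables (F : finFieldType) (psi : addCF F).
Hypotheses (psi_char : psi \is a linear_char) (psi_neq1 : psi != 1).
Notation U := {unit F}.
Implicit Types (alpha beta gamma mu nu : mulCF F).

Lemma sum_pair (R : nmodType) (I J : finType) (f : I * J -> R) :
  \sum_p f p = \sum_i \sum_j f (i, j).
Proof. by rewrite pair_bigA; apply: eq_bigr => -[]. Qed.

Lemma ext0_unit mu (u : U) : ext0 mu (val u) = mu u.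
Proof. by rewrite /ext0 valK. Qed.

(** Writing the condition [x + y = 1] as a factor keeps both variables free, which lets the large
    sums factor. *)
Lemma jacobi_indicator alpha beta :
  \sum_x \sum_y (alpha x * beta y) * (val x + val y == 1)%:R = - jacobi alpha beta.
Proof.
rewrite opprK; apply: eq_bigr => x _; rewrite [RHS]big_mkcond.
by apply: eq_bigr => y _; case: ifP; rewrite ?mulr1 ?mulr0.
Qed.

Lemma unit_indicator (u : U) :
  (u == 1%g)%:R = (qC F - 1)^-1 * \sum_(mu <- irr [set: U]%G) mu u.
Proof.
rewrite sum_irr_abelian ?card_unit_natr; last exact: unit_abelian.
rewrite mulrnAr mulVf // -card_unit_natr pnatr_eq0 -lt0n.
exact: (cardG_gt0 [set: U]%G).
Qed.

(** Each indicator is expanded by orthogonality over the characters of the unit group. The two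
    factors [(q - 1)^-1] multiply to the normalisation [(1 - q)^-2] of the hypergeometric sums. *)
Lemma sum_unit_indicator2 (I : finType) (T : I -> algC) (u v : I -> U) :
  \sum_i T i * (u i == 1%g)%:R * (v i == 1%g)%:R
  = ((1 - qC F) ^+ 2)^-1 * \sum_(mu <- irr [set: U]%G)
      \sum_(nu <- irr [set: U]%G) \sum_i T i * mu (u i) * nu (v i).
Proof.
transitivity (((1 - qC F) ^+ 2)^-1 * \sum_i \sum_(mu <- irr [set: U]%G)
   \sum_(nu <- irr [set: U]%G) T i * mu (u i) * nu (v i)).
  rewrite mulr_sumr; apply: eq_bigr => i _; rewrite !unit_indicator.
  transitivity (((1 - qC F) ^+ 2)^-1 * (T i *
      ((\sum_(mu <- irr [set: U]%G) mu (u i)) * \sum_(nu <- irr [set: U]%G) nu (v i)))).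
    rewrite -sqrrN opprB expr2 invfM; ring.
  congr (_ * _); rewrite big_distrlr mulr_sumr; apply: eq_bigr => mu _.
  by rewrite mulr_sumr; apply: eq_bigr => nu _; rewrite mulrA.
rewrite exchange_big /=; congr (_ * _); apply: eq_bigr => mu _.
exact: exchange_big.
Qed.

(** The pairing of variables 1 with 3 and 2 with 4 follows the two equations [x_i^N + y_i^N = 1];
    variable 5 stands for [z^N]. *)
Lemma sum_prod5 (f h : U -> U -> algC) (k : U -> algC) :
  \sum_(x : U * U * U * U * U) (let: (x1, x2, x3, x4, x5) := x in
     f x1 x3 * h x2 x4 * k x5)
  = (\sum_x \sum_y f x y) * (\sum_x \sum_y h x y) * \sum_x k x.
Proof.
rewrite !sum_pair big_distrlr mulr_suml; apply: eq_bigr => x1 _.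
rewrite mulr_suml; apply: eq_bigr => x2 _.
rewrite big_distrlr mulr_suml; apply: eq_bigr => x3 _.
rewrite mulr_suml; apply: eq_bigr => x4 _.
by rewrite mulr_sumr.
Qed.

Lemma sum_prod4 (f : U -> U -> algC) (h k : U -> algC) :
  \sum_(x : U * U * U * U) (let: (x1, x2, x3, x4) := x in f x1 x2 * h x3 * k x4)
  = (\sum_x \sum_y f x y) * (\sum_x h x) * \sum_x k x.
Proof.
rewrite !sum_pair !mulr_suml; apply: eq_bigr => x1 _.
rewrite !mulr_suml; apply: eq_bigr => x2 _.
rewrite -mulrA big_distrlr mulr_sumr; apply: eq_bigr => x3 _.
by rewrite mulr_sumr; apply: eq_bigr => x4 _; rewrite mulrA.
Qed.

(** * The sum for [Phi1] *)

Section Phi1Sum.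
Variables (alpha1 alpha2 beta1 beta2 gamma : mulCF F) (c l1 l2 : U).
Hypotheses (lin_a1 : alpha1 \is a linear_char) (lin_a2 : alpha2 \is a linear_char).
Hypotheses (lin_b1 : beta1 \is a linear_char) (lin_b2 : beta2 \is a linear_char).
Hypotheses (lin_g : gamma \is a linear_char).
Hypotheses (ab1_neq1 : alpha1 * beta1 != 1) (ab2_neq1 : alpha2 * beta2 != 1).

Definition term_Phi1 (x : U * U * U * U * U) : algC :=
  let: (x1, x2, x3, x4, x5) := x in
  (alpha1 x1 * beta1 x3 * (val x1 + val x3 == 1)%:R)
  * (alpha2 x2 * beta2 x4 * (val x2 + val x4 == 1)%:R)
  * (gamma x5 * psi (val c * val x5)).

(** Quotient of the two sides of the equation in [l1], which thus holds exactly when the ratio is 1;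
    [ratio2_Phi1] does the same for [l2]. *)
Definition ratio1_Phi1 (x : U * U * U * U * U) : U :=
  let: (x1, x2, x3, x4, x5) := x in (l1 * x1 * x2 * (x3 * x4)^-1)%g.

Definition ratio2_Phi1 (x : U * U * U * U * U) : U :=
  let: (x1, x2, x3, x4, x5) := x in (l2 * x1 * (x3 * x5)^-1)%g.

Lemma sum_cond_Phi1 :
  \sum_(g | cond_Phi1 (val l1) (val l2) g)
     chi_Phi1 psi alpha1 alpha2 beta1 beta2 gamma (val c) g
  = \sum_x term_Phi1 x * (ratio1_Phi1 x == 1%g)%:R * (ratio2_Phi1 x == 1%g)%:R.
Proof.
rewrite big_mkcond sum_pair; apply: eq_bigr => -[[[[x1 x2] x3] x4] x5] _.
(* The additive component is forced to be [a = x5], so the sum over [a] has one surviving term. *)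
rewrite (bigD1 (val x5)) //= big1 ?addr0 => [|a /negPf a_neq]; last first.
  by rewrite a_neq !andbF.
rewrite -!eq_mulgV1 -!val_eqE /= eqxx /=.
do 4![case: (_ == _ :> F); rewrite ?mulr1 ?mulr0 ?mul0r //=].
rewrite /twist; ring.
Qed.

(** Collecting [mu] and [nu] variable by variable shifts [alpha1, beta1] by [mu * nu] and its
    inverse, [alpha2, beta2] by [mu] and its inverse, and [gamma] by [nu^-1]. The sum factors into
    two Jacobi sums and a twisted Gauss sum, whose twist contributes [nu c] and so turns [l2] into
    [c * l2]. *)
Lemma sum_term_Phi1 mu nu : mu \is a linear_char -> nu \is a linear_char ->
  \sum_x term_Phi1 x * mu (ratio1_Phi1 x) * nu (ratio2_Phi1 x)
  = - gauss psi gamma * gamma^-1 c * jacobi alpha1 beta1 * jacobi alpha2 beta2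
    * ((poch psi alpha1 (mu * nu) * poch psi alpha2 mu)
       / (poch0 psi beta1^-1 (mu * nu) * poch0 psi beta2^-1 mu
          * poch0 psi gamma^-1 nu)
       * mu l1 * nu (c * l2)%g).
Proof.
move=> lin_m lin_n.
have lin_mn : mu * nu \is a linear_char by rewrite rpredM.
have lin_gn : gamma * nu^-1 \is a linear_char by rewrite rpredM ?rpredV.
transitivity (mu l1 * nu l2 *
  ((\sum_x \sum_y ((alpha1 * (mu * nu)) x * (beta1 * (mu * nu)^-1) y)
       * (val x + val y == 1)%:R)
   * (\sum_x \sum_y ((alpha2 * mu) x * (beta2 * mu^-1) y)
       * (val x + val y == 1)%:R)
   * \sum_x (gamma * nu^-1) x * psi (val c * val x))).
  rewrite -sum_prod5 mulr_sumr; apply: eq_bigr => -[[[[x1 x2] x3] x4] x5] _ /=.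
  rewrite !lin_charTM ?lin_charTV ?lin_charTM // !cfunE !lin_charT_inv // cfunE !invfM.
  ring.
rewrite !jacobi_indicator gauss_twist // gauss_mulV //.
rewrite !(jacobi_shift psi_char psi_neq1) //.
(* [invfM] would otherwise unfold [poch0]. *)
move: (poch0 psi beta1^-1 _) (poch0 psi beta2^-1 _) (poch0 psi gamma^-1 _) => p1 p2 p3.
rewrite !lin_charT_inv // [(gamma * _) c]cfunE !lin_charT_inv // [(mu * nu) _]cfunE.
rewrite lin_charTM // !invfM invrK.
have := lin_char_unitN1_sqr lin_m; have := lin_char_unitN1_sqr lin_n.
move: (mu (unitN1 F)) (nu (unitN1 F)) => s t tt ss.
(* The first Jacobi sum contributes the sign [s t], the second [s] and the Gauss sum [t], with
   [s = mu(-1)] and [t = nu(-1)]; their product is inserted on the right as 1. *)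
have st : s * s * (t * t) = 1 by rewrite ss tt mulr1.
rewrite -[RHS]mul1r -[in RHS]st.
move: (jacobi alpha1 beta1) (jacobi alpha2 beta2) (gauss psi gamma) => j1 j2 g.
move: (poch psi alpha1 _) (poch psi alpha2 _) => q1 q2.
ring.
Qed.

Lemma sum_cond_Phi1E :
  \sum_(g | cond_Phi1 (val l1) (val l2) g)
     chi_Phi1 psi alpha1 alpha2 beta1 beta2 gamma (val c) g
  = - gauss psi gamma * ext0 gamma^-1 (val c)
    * jacobi alpha1 beta1 * jacobi alpha2 beta2
    * Phi1 psi alpha1 alpha2 beta1^-1 beta2^-1 gamma^-1 (val l1) (val c * val l2).
Proof.
rewrite sum_cond_Phi1 sum_unit_indicator2 ext0_unit /Phi1 mulrCA; congr (_ * _).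
rewrite mulr_sumr; apply: eq_big_seq => mu /irr_lin_char lin_m.
rewrite mulr_sumr; apply: eq_big_seq => nu /irr_lin_char lin_n.
by rewrite sum_term_Phi1 // -FinRing.val_unitM !ext0_unit.
Qed.

End Phi1Sum.

(** * The sum for [Phi3] *)

Section Phi3Sum.
Variables (alpha beta gamma1 gamma2 : mulCF F) (c1 c2 l1 l2 : U).
Hypotheses (lin_a : alpha \is a linear_char) (lin_b : beta \is a linear_char).
Hypotheses (lin_g1 : gamma1 \is a linear_char) (lin_g2 : gamma2 \is a linear_char).
Hypotheses (ab_neq1 : alpha * beta != 1).

Definition term_Phi3 (x : U * U * U * U) : algC :=
  let: (x1, x2, x3, x4) := x in
  (alpha x1 * beta x2 * (val x1 + val x2 == 1)%:R)
  * (gamma1 x3 * psi (val c1 * val x3)) * (gamma2 x4 * psi (val c2 * val x4)).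

Definition ratio1_Phi3 (x : U * U * U * U) : U :=
  let: (x1, x2, x3, x4) := x in (l1 * x1 * (x2 * x3)^-1)%g.

Definition ratio2_Phi3 (x : U * U * U * U) : U :=
  let: (x1, x2, x3, x4) := x in (l2 * (x3 * x4)^-1)%g.

Lemma sum_cond_Phi3 :
  \sum_(g | cond_Phi3 (val l1) (val l2) g)
     chi_Phi3 psi alpha beta gamma1 gamma2 (val c1) (val c2) g
  = \sum_x term_Phi3 x * (ratio1_Phi3 x == 1%g)%:R * (ratio2_Phi3 x == 1%g)%:R.
Proof.
rewrite big_mkcond 2!sum_pair; apply: eq_bigr => -[[[x1 x2] x3] x4] _.
(* Both additive components are determined: first [a1 = x3], then [a2 = x4]. *)
rewrite (bigD1 (val x3)) //= [X in _ + X]big1 ?addr0 => [|a /negPf a_neq]; last first.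
  by apply: big1 => b _; rewrite a_neq andbF.
rewrite (bigD1 (val x4)) //= big1 ?addr0 => [|a /negPf a_neq]; last first.
  by rewrite a_neq !andbF.
rewrite -!eq_mulgV1 -!val_eqE /= !eqxx /=.
do 3![case: (_ == _ :> F); rewrite ?mulr1 ?mulr0 ?mul0r //=].
rewrite /twist; ring.
Qed.

(** Here [alpha, beta] are shifted by [mu] and its inverse, [gamma1] by [(mu * nu)^-1] and [gamma2]
    by [nu^-1]. The twist by [c1] therefore contributes [(mu * nu) c1] and that by [c2] contributes
    [nu c2], whence the arguments [c1 * l1] and [c1 * c2 * l2]. *)
Lemma sum_term_Phi3 mu nu : mu \is a linear_char -> nu \is a linear_char ->
  \sum_x term_Phi3 x * mu (ratio1_Phi3 x) * nu (ratio2_Phi3 x)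
  = - ((gauss psi gamma1 * gamma1^-1 c1) * (gauss psi gamma2 * gamma2^-1 c2))
    * jacobi alpha beta
    * (poch psi alpha mu
       / (poch0 psi gamma1^-1 (mu * nu) * poch0 psi beta^-1 mu
          * poch0 psi gamma2^-1 nu)
       * mu (c1 * l1)%g * nu (c1 * c2 * l2)%g).
Proof.
move=> lin_m lin_n.
have lin_mn : mu * nu \is a linear_char by rewrite rpredM.
have lin_g1mn : gamma1 * (mu * nu)^-1 \is a linear_char by rewrite rpredM ?rpredV.
have lin_g2n : gamma2 * nu^-1 \is a linear_char by rewrite rpredM ?rpredV.
transitivity (mu l1 * nu l2 *
  ((\sum_x \sum_y ((alpha * mu) x * (beta * mu^-1) y) * (val x + val y == 1)%:R)
   * (\sum_x (gamma1 * (mu * nu)^-1) x * psi (val c1 * val x))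
   * \sum_x (gamma2 * nu^-1) x * psi (val c2 * val x))).
  rewrite -sum_prod4 mulr_sumr; apply: eq_bigr => -[[[x1 x2] x3] x4] _ /=.
  rewrite !lin_charTM ?lin_charTV ?lin_charTM // !cfunE !lin_charT_inv // cfunE !invfM.
  ring.
rewrite !jacobi_indicator !gauss_twist // !gauss_mulV //.
rewrite (jacobi_shift psi_char psi_neq1) //.
move: (poch0 psi beta^-1 _) (poch0 psi gamma1^-1 _) (poch0 psi gamma2^-1 _) => p1 p2 p3.
rewrite !lin_charT_inv // [(gamma1 * _) c1]cfunE [(gamma2 * _) c2]cfunE.
rewrite !lin_charT_inv // ![(mu * nu) _]cfunE !lin_charTM // !invfM !invrK.
have := lin_char_unitN1_sqr lin_m; have := lin_char_unitN1_sqr lin_n.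
move: (mu (unitN1 F)) (nu (unitN1 F)) => s t tt ss.
(* The signs are [s] from the Jacobi sum, [s t] from the Gauss sum of [gamma1] and [t] from that of
   [gamma2]. *)
have st : s * s * (t * t) = 1 by rewrite ss tt mulr1.
rewrite -[RHS]mul1r -[in RHS]st.
move: (jacobi alpha beta) (gauss psi gamma1) (gauss psi gamma2) => j g1 g2.
move: (poch psi alpha _) => q1.
ring.
Qed.

Lemma sum_cond_Phi3E :
  \sum_(g | cond_Phi3 (val l1) (val l2) g)
     chi_Phi3 psi alpha beta gamma1 gamma2 (val c1) (val c2) g
  = - ((gauss psi gamma1 * ext0 gamma1^-1 (val c1))
       * (gauss psi gamma2 * ext0 gamma2^-1 (val c2)))
    * jacobi alpha beta
    * Phi3 psi alpha gamma1^-1 beta^-1 gamma2^-1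
        (val c1 * val l1) (val c1 * val c2 * val l2).
Proof.
rewrite sum_cond_Phi3 sum_unit_indicator2 !ext0_unit /Phi3 mulrCA; congr (_ * _).
rewrite mulr_sumr; apply: eq_big_seq => mu /irr_lin_char lin_m.
rewrite mulr_sumr; apply: eq_big_seq => nu /irr_lin_char lin_n.
by rewrite sum_term_Phi3 // -!FinRing.val_unitM !ext0_unit.
Qed.

End Phi3Sum.

End CharacterSums.

(** * Assembly of the point counts and the character sums *)

Theorem theorem4p12 (F : finFieldType)
    (K : closedFieldType) (iota : {rmorphism F -> K})
    (K_algebraic : forall x : K, algebraicOver iota x)
    (psi : addCF F) (psi_char : psi \is a linear_char) (psi_neq1 : psi != 1)
    (l1 l2 : F) (l1_neq0 : l1 != 0) (l2_neq0 : l2 != 0) :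
  (forall (alpha1 alpha2 beta1 beta2 gamma : mulCF F) (c : F),
     alpha1 \is a linear_char -> alpha2 \is a linear_char ->
     beta1 \is a linear_char -> beta2 \is a linear_char ->
     gamma \is a linear_char -> c != 0 ->
     alpha1 * beta1 != 1 -> alpha2 * beta2 != 1 ->
     Nchar F (X_Phi1 iota l1 l2) (act_Phi1 iota)
       (chi_Phi1 psi alpha1 alpha2 beta1 beta2 gamma c) =
     - gauss psi gamma * ext0 gamma^-1 c
     * jacobi alpha1 beta1 * jacobi alpha2 beta2
     * Phi1 psi alpha1 alpha2 beta1^-1 beta2^-1 gamma^-1 l1 (c * l2))
  /\
  (forall (alpha beta gamma1 gamma2 : mulCF F) (c1 c2 : F),
     alpha \is a linear_char -> beta \is a linear_char ->
     gamma1 \is a linear_char -> gamma2 \is a linear_char ->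
     c1 != 0 -> c2 != 0 ->
     alpha * beta != 1 ->
     Nchar F (X_Phi3 iota l1 l2) (act_Phi3 iota)
       (chi_Phi3 psi alpha beta gamma1 gamma2 c1 c2) =
     - ((gauss psi gamma1 * ext0 gamma1^-1 c1)
        * (gauss psi gamma2 * ext0 gamma2^-1 c2))
     * jacobi alpha beta
     * Phi3 psi alpha gamma1^-1 beta^-1 gamma2^-1 (c1 * l1) (c1 * c2 * l2)).
Proof.
(* The character sums are stated for parameters in the unit group, so the nonzero field elements are
   first lifted to units. *)
have nz_unit (x : F) : x != 0 -> exists u : {unit F}, x = val u.
  by rewrite -unitfE => x_unit; exists (FinRing.unit F x_unit).
have [L1 ->] := nz_unit _ l1_neq0; have [L2 ->] := nz_unit _ l2_neq0; split.
  move=> alpha1 alpha2 beta1 beta2 gamma c ? ? ? ? ? /nz_unit[C ->] ? ?.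
  by rewrite Nchar_Phi1 sum_cond_Phi1E.
move=> alpha beta gamma1 gamma2 c1 c2 ? ? ? ? /nz_unit[C1 ->] /nz_unit[C2 ->] ?.
by rewrite Nchar_Phi3 sum_cond_Phi3E.
Qed.
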